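(* Let $K$ and $L$ be infinite compact Hausdorff spaces. Then the space $C_p(K\times L)$ contains a complemented copy of the space $(c_0)_p$; that is, there is a complemented closed linear subspace $E$ of $C_p(K\times L)$ which, with the subspace topology, is linearly homeomorphic to $(c_0)_p$.
   Context: For a Tychonoff space $X$, $C_p(X)$ denotes the space of all continuous real-valued functions on $X$ equipped with the pointwise topology (the topology inherited from the product $\mathbb{R}^X$). $(c_0)_p$ denotes the vector space $c_0$ of all real sequences converging to $0$, equipped with the topology inherited from the product $\mathbb{R}^{\mathbb{N}}$. A closed linear subspace $E$ of a topological vector space $Z$ is complemented if there is a continuous linear projection from $Z$ onto $E$ (equivalently, $Z$ is the topological direct sum $E\oplus F$ for some closed linear subspace $F$). *)

(* Defs.v *)
From HB Require Import structures.
From mathcomp Require Import all_boot all_order all_algebra.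
From mathcomp Require Import all_classical all_reals all_analysis.

Set Implicit Arguments.
Unset Strict Implicit.
Unset Printing Implicit Defensive.

Import Order.TTheory GRing.Theory Num.Theory.
Import numFieldNormedType.Exports.

Local Open Scope classical_set_scope.
Local Open Scope ring_scope.

(* A linear subspace S of R^T, as a topological vector space for the topology
   inherited from the product topology {ptws T -> R}. *)
Section PointwiseSubspace.
Variables (R : realType) (T : Type) (S : submodClosed (T -> R^o)).

Record ptws_subspace := PtwsSubspace {
  ptws_fun :> T -> R;
  ptws_funP : ptws_fun \in S }.

HB.instance Definition _ := [isSub for ptws_fun].
HB.instance Definition _ := [Choice of ptws_subspace by <:].
HB.instance Definition _ := [SubChoice_isSubLmodule of ptws_subspace by <:].
HB.instance Definition _ := Topological.copy ptws_subspace
  (initial_topology (ptws_fun : ptws_subspace -> {ptws T -> R})).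

Lemma ptws_subspace_cvgP (F : set_system ptws_subspace) (f : ptws_subspace) :
  Filter F ->
  F --> f <-> forall t, (fun g : ptws_subspace => g t) @ F --> (f t : R).
Proof.
move=> FF.
have initP (U : choiceType) (V : topologicalType) (w : U -> V)
    (G : set_system U) (u : U) : Filter G ->
    G --> (u : initial_topology w) <-> w @ G --> w u.
  move=> FG; split=> [Gu A /initial_continuous /Gu //|].
  move=> Gu A /= [_ [[B Bop <-] Bu sBA]].
  have /Gu : nbhs (w u) B by apply: open_nbhs_nbhs.
  exact: (@filterS _ G _ _ _ sBA).
rewrite (initP _ {ptws T -> R}) cvg_sup.
by split=> Ff t; have := Ff t; rewrite initP.
Qed.

Lemma ptws_subspace_addE (f g : ptws_subspace) t : (f + g) t = f t + g t.
Proof. by []. Qed.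

Lemma ptws_subspace_scaleE (a : R) (f : ptws_subspace) t : (a *: f) t = a * f t.
Proof. by []. Qed.

Let eval_cvg (t : T) (f : ptws_subspace) :
  (fun g : ptws_subspace => g t) @ f --> (f t : R).
Proof.
by have /(@ptws_subspace_cvgP _ f (nbhs_filter f)) := @cvg_id _ (nbhs f); apply.
Qed.

Let add_continuous :
  continuous (fun f : ptws_subspace * ptws_subspace => f.1 + f.2).
Proof.
move=> [f g]; apply/ptws_subspace_cvgP => t.
have ft :
    (fun h : ptws_subspace * ptws_subspace => h.1 t) @ (f, g) --> (f t : R).
  exact: (cvg_comp _ _ cvg_fst (@eval_cvg t f)).
have gt :
    (fun h : ptws_subspace * ptws_subspace => h.2 t) @ (f, g) --> (g t : R).
  exact: (cvg_comp _ _ cvg_snd (@eval_cvg t g)).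
exact: (@cvgD _ R^o _ _ _ _ _ _ _ ft gt).
Qed.

HB.instance Definition _ :=
  PreTopologicalNmodule_isTopologicalNmodule.Build ptws_subspace add_continuous.

Let scale_continuous : continuous (fun z : R^o * ptws_subspace => z.1 *: z.2).
Proof.
move=> [a f]; apply/ptws_subspace_cvgP => t.
have ft : (fun z : R^o * ptws_subspace => z.2 t) @ (a, f) --> (f t : R).
  exact: (cvg_comp _ _ cvg_snd (@eval_cvg t f)).
exact: (@cvgM _ _ _ _ _ _ _ _ cvg_fst ft).
Qed.

HB.instance Definition _ :=
  TopologicalNmodule_isTopologicalLmodule.Build R ptws_subspace
    scale_continuous.

End PointwiseSubspace.

Section Cp.
Variables (R : realType) (X : topologicalType).

Definition continuous_pred : {pred X -> R^o} :=
  fun f => `[< continuous (f : X -> R) >].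

Let continuous_pred_closed : GRing.submod_closed continuous_pred.
Proof.
split=> [|a f g /asboolP fc /asboolP gc]; apply/asboolP => x.
  exact: (@cvg_cst R).
by apply: (@cvgD _ R^o); [exact: (@cvgZl_tmp _ R^o) (fc x)|exact: gc].
Qed.

HB.instance Definition _ :=
  GRing.isSubmodClosed.Build _ _ continuous_pred
    (GRing.submod_closed_semi continuous_pred_closed).

Definition Cp : topologicalLmodType R := ptws_subspace continuous_pred.

End Cp.

Section c0p.
Variable R : realType.

Definition c0_pred : {pred nat -> R^o} :=
  fun u => `[< (u : nat -> R) @ \oo --> (0 : R) >].

Let c0_pred_closed : GRing.submod_closed c0_pred.
Proof.
split=> [|a u v /asboolP uc /asboolP vc]; apply/asboolP.
  exact: (@cvg_cst R).
rewrite -[X in _ --> X]addr0 -[X in _ --> X + _](mulr0 a).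
by apply: (@cvgD _ R^o); [exact: (@cvgZl_tmp _ R^o)|].
Qed.

HB.instance Definition _ :=
  GRing.isSubmodClosed.Build _ _ c0_pred
    (GRing.submod_closed_semi c0_pred_closed).

Definition c0p : topologicalLmodType R := ptws_subspace c0_pred.

End c0p.

Section Complemented.
Variables (R : realType) (Z : topologicalLmodType R).

Definition closed_linear_subspace (E : set Z) :=
  GRing.submod_closed (fun x : Z => x \in E) /\ closed E.

Definition complemented (E : set Z) :=
  closed_linear_subspace E /\
  exists P : {linear Z -> Z},
    [/\ continuous P, range P = E & {in E, forall x, P x = x}].

(* T is a linear homeomorphism of W onto E, the latter with the subspace
   topology; only the values on E of the inverse S matter. *)
Definition linearly_homeomorphic (E : set Z) (W : topologicalLmodType R) :=
  exists (T : {linear W -> Z}) (S : Z -> W),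
    [/\ range T = E, cancel T S, continuous T & {within E, continuous S}].

End Complemented.

(* Main.v *)
(* Both spaces contain sequences of points x_j, y_j with disjointly supported
   bump functions phi_j, psi_j. Index a block of x's by the sign vectors
   s in {-1,1}^N and a block of y's by i < N, all blocks being disjoint, and put
     mu_N = (N 2^N)^-1 \sum_(s,i) s_i delta_(x_s, y_i),
     f_N = \sum_(s,i) s_i phi_s (x) psi_i,
   so that mu_M(f_N) = delta_MN. Khinchine's inequality in its second-moment
   form gives |mu_N(a (x) b)| <= |a| |b| / sqrt N for arbitrary bounded
   functions a, b, and a continuous function on the product of two compact spaces is
   uniformly close to a finite sum of such products; hence mu_N(g) -> 0 for
   every continuous g. Thus g |-> (mu_N(g))_N maps C_p into c_0 and is a left
   inverse of u |-> \sum_N u_N f_N; both maps are continuous since each mu_N is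
   finitely supported and the f_N have disjoint supports. *)
From HB Require Import structures.
Require Import Defs.
From mathcomp Require Import all_boot all_order all_algebra.
From mathcomp Require Import all_classical all_reals all_analysis.
From mathcomp Require Import ring lra.

Set Implicit Arguments.
Unset Strict Implicit.
Unset Printing Implicit Defensive.

Import Order.TTheory GRing.Theory Num.Theory.
Import numFieldNormedType.Exports.

Local Open Scope classical_set_scope.
Local Open Scope ring_scope.

(** * Compactness and disjointly supported bump functions *)

(* The library states the equivalence of [compact] with the open-cover property
   for pointed spaces only. *)
Lemma compact_finite_cover (X : topologicalType) (U : X -> set X) :
  compact [set: X] -> (forall x, nbhs x (U x)) ->
  exists D : seq X, forall t, exists2 x, x \in D & U x t.
Proof.
move=> /compact_near_coveringP Xc Ux.
(* The filter of all large enough finite sequences: a near covering along it gives one sequence that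
   serves every point. *)
pose F :=
  filter_from setT (fun D : seq X => [set D' : seq X | {subset D <= D'}]).
have FF : Filter F.
  apply: filter_from_filter; first by exists [::].
  move=> D1 D2 _ _; exists (D1 ++ D2) => // D' sD.
  by split=> x xD; apply: sD; rewrite mem_cat xD ?orbT.
have [|D _ DP] := Xc _ F (fun D t => exists2 x, x \in D & U x t) FF.
  move=> x _; exists (U x, [set D : seq X | x \in D]) => /=.
    split; first exact: Ux.
    by exists [:: x] => // D; apply; rewrite mem_head.
  by move=> [t D] /= [Uxt xD]; exists x.
by exists D => t; apply: (DP D).
Qed.

(** Otherwise every singleton is open and finitely many of them cover the space. *)
Lemma compact_infinite_accumulation (X : topologicalType) :
  compact [set: X] -> infinite_set [set: X] ->
  exists p : X, forall V, nbhs p V -> exists2 q, V q & q != p.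
Proof.
move=> Xc; apply: contra_notP => noacc.
have op1 (p : X) : open [set p].
  rewrite openE => q ->{q}; rewrite /interior.
  apply: contrapT => np; apply: noacc; exists p => V Vp.
  apply: contrapT => nq; apply: np; apply: filterS Vp => q Vq /=.
  by apply: contrapT => qp; apply: nq; exists q => //; apply/eqP.
have [x|D Dcov] := compact_finite_cover (U := fun p => [set p]) Xc.
  exact/open_nbhs_nbhs.
apply: (@sub_finite_set _ _ [set` D]) => // p _.
by have [q qD ->] := Dcov p.
Qed.

(** Neighbourhoods [O n] of an accumulation point [p] shrink by means of Urysohn functions [h n]
    that vanish at [p] and off [O n] and equal 1 at some point of [O n]; the [n]-th bump lives in
    [O n] minus [O n.+1]. *)
Lemma compact_hausdorff_bumps (R : realType) (X : topologicalType) :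
  compact [set: X] -> hausdorff_space X -> infinite_set [set: X] ->
  exists (x : nat -> X) (phi : nat -> X -> R),
    [/\ forall n, continuous (phi n),
        forall n t, 0 <= phi n t <= 1,
        forall n, phi n (x n) = 1 &
        forall t m n, phi m t != 0 -> phi n t != 0 -> m = n].
Proof.
move=> Xc XH Xinf.
have [p pacc] := compact_infinite_accumulation Xc Xinf.
have Xn := compact_normal XH Xc.
have step (O : set X) : exists qh : X * (X -> R),
    open_nbhs p O -> [/\ continuous qh.2, range qh.2 `<=` `[0, 1],
      qh.2 qh.1 = 1, qh.2 p = 0 & forall t, ~ O t -> qh.2 t = 0].
  have [Op|] := pselect (open_nbhs p O); last by exists (p, cst 0).
  have [q Oq qp] := pacc _ (open_nbhs_nbhs Op).
  have clA : closed ([set p] `|` ~` O).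
    apply: closedU.
      exact: accessible_closed_set1 (hausdorff_accessible XH) _.
    by apply: open_closedC; case: Op.
  have clB : closed [set q].
    exact: accessible_closed_set1 (hausdorff_accessible XH) _.
  have AB : ([set p] `|` ~` O) `&` [set q] = set0.
    by rewrite -subset0 => t [[->|nO] /= tq];
      [move: qp; rewrite tq eqxx | apply: nO; rewrite tq].
  have [h [hc hA hB h01]] := urysohn_ext_itv Xn clA clB AB (@ltr01 R).
  exists (q, h) => _; split=> //=.
  - by apply: hB; exists q.
  - by apply: hA; exists p => //; left.
  - by move=> t nO; apply: hA; exists t => //; right.
have [G GP] := choice step.
pose next O := O `&` (G O).2 @^-1` [set r | r < 2^-1].
pose O n := iter n next setT.
have Oop n : open_nbhs p (O n).
  elim: n => [|n [Oo Op]]; first by split=> //; exact: openT.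
  have [hc _ _ hp _] := GP _ (conj Oo Op).
  split; last by split => //=; rewrite hp invr_gt0 ltr0n.
  apply: openI => //; apply: open_comp => //; exact: open_lt.
pose h n := (G (O n)).2.
(* Cutting at 1/2 kills the bump on [O n.+1], where [h n] is below 1/2, and preserves the value
   1. *)
pose phi n t := Num.max 0 (2 * h n t - 1).
have subO m n : (m <= n)%N -> O n `<=` O m.
  elim: n => [|n IHn]; first by rewrite leqn0 => /eqP ->.
  rewrite leq_eqVlt => /predU1P[-> //|/IHn mn]; apply: subset_trans mn.
  by move=> t [].
have phiO n t : phi n t != 0 -> O n t /\ ~ O n.+1 t.
  have [_ _ _ _ h0] := GP _ (Oop n).
  move=> phin; split; first apply: contrapT => /h0 hn0.
    by move: phin; rewrite /phi /h hn0 mulr0 sub0r max_l ?eqxx// lerN10.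
  case=> _ /= hlt; move: phin; rewrite /phi max_l ?eqxx// /h; lra.
exists (fun n => (G (O n)).1), phi; split=> [n t|n t|n|t m n].
- have [hc _ _ _ _] := GP _ (Oop n).
  apply: (@continuous_max R X (cst 0) (fun t => 2 * h n t - 1)).
    exact: cst_continuous.
  apply: (@continuousB R R^o); last exact: cst_continuous.
  by apply: (@continuousM R); [exact: cst_continuous|exact: hc].
- have [_ h01 _ _ _] := GP _ (Oop n).
  have := h01 (h n t); rewrite /= in_itv/= => /(_ (ex_intro2 _ _ t I erefl)).
  case/andP => h0 h1; rewrite /phi le_max lexx ge_max ler01/=; lra.
- have [_ _ h1 _ _] := GP _ (Oop n).
  by rewrite /phi /h h1 max_r; lra.
- move=> /phiO[Om Om1] /phiO[On On1].
  case: (ltngtP m n) => // [mn|nm].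
    by case: Om1; apply: subO On.
  by case: On1; apply: subO Om.
Qed.

(** * Complemented copies from continuous left inverses *)

(** The projection is [T \o A]; its set of fixed points is [range T], which is closed since [Z] is
    Hausdorff. *)
Lemma retract_complemented (R : realType) (Z W : topologicalLmodType R)
    (T : {linear W -> Z}) (A : {linear Z -> W}) :
  hausdorff_space Z -> continuous T -> continuous A -> cancel T A ->
  complemented (range T) /\ linearly_homeomorphic (range T) W.
Proof.
move=> ZH Tc Ac TK.
have TAc : continuous (T \o A).
  by move=> z; apply: continuous_comp; [exact: Ac|exact: Tc].
have TAE z : range T z -> T (A z) = z by move=> [w _ <-]; rewrite TK.
split; last first.
  exists T, A; split=> //; exact: continuous_subspaceT.
split; last first.
  exists (T \o A : {linear Z -> Z}); split=> //.
    apply/seteqP; split=> [_ [z _ <-]|_ [w _ <-]]; first by exists (A z).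
    by exists (T w) => //=; rewrite TK.
  by move=> z /set_mem /TAE.
split.
  split=> [|a x y]; first by apply/mem_set; exists 0; rewrite // linear0.
  move=> /set_mem[u _ <-] /set_mem[v _ <-]; apply/mem_set.
  by exists (a *: u + v); rewrite // linearP.
move=> z zE; exists (A z) => //; apply: ZH => U V UTz Vz.
have TAU : nbhs z ((T \o A) @^-1` U) by exact: TAc.
have [e [Ee [Ue Ve]]] := zE _ (filterI TAU Vz).
by exists e; split=> //; rewrite -(TAE e Ee).
Qed.

(** * Evaluations on pointwise function spaces *)

Section PointwiseSubspaceTheory.
Variables (R : realType) (T : Type) (S : submodClosed (T -> R^o)).

Lemma ptws_subspace_eval_continuous (t : T) :
  continuous (fun f : ptws_subspace S => f t : R).
Proof.
move=> f.
by have /(ptws_subspace_cvgP f (nbhs_filter f)) := @cvg_id _ (nbhs f); apply.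
Qed.

Lemma ptws_subspace_ext (f g : ptws_subspace S) :
  (forall t, f t = g t) -> f = g.
Proof. by move=> fg; apply: val_inj; apply/funext. Qed.

Lemma ptws_subspace_hausdorff : hausdorff_space (ptws_subspace S).
Proof.
move=> f g fg; apply: ptws_subspace_ext => t.
apply: Rhausdorff => U V Uf Vg.
have [h [Uh Vh]] := fg _ _ (ptws_subspace_eval_continuous Uf)
  (ptws_subspace_eval_continuous Vg).
by exists (h t).
Qed.

End PointwiseSubspaceTheory.

Lemma continuous_sumr (R : realType) (Y : topologicalType) (I : Type)
    (r : seq I) (F : I -> Y -> R) :
  (forall i, continuous (F i)) -> continuous (fun y => \sum_(i <- r) F i y).
Proof.
by move=> Fc; apply: continuous_big => // x; exact: (@add_continuous R^o).
Qed.

(** * Series of disjointly supported functions *)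

Section DisjointlySupported.
Variables (R : realType) (X : topologicalType) (f : nat -> X -> R).
Hypothesis f_continuous : forall n, continuous (f n).
Hypothesis f_le1 : forall n t, `|f n t| <= 1.
Hypothesis f_disjoint : forall t m n, f m t != 0 -> f n t != 0 -> m = n.

Lemma exists_active_index :
  exists k : X -> nat, forall t m, m != k t -> f m t = 0.
Proof.
suff /choice[k kP] : forall t, exists n, forall m, m != n -> f m t = 0.
  by exists k.
move=> t; have [[n fn]|f0] := pselect (exists n, f n t != 0).
  exists n => m mn; apply/eqP; apply: contraNT mn => fm.
  exact/eqP/(f_disjoint fm fn).
(* Where all [f n] vanish any index will do; 0 is the default. *)
exists 0%N => m _; apply/eqP; apply: contrapT => /negP fm.
by apply: f0; exists m.
Qed.

Variable k : X -> nat.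
Hypothesis kP : forall t m, m != k t -> f m t = 0.

(* The pointwise sum of the series [\sum_n u n *: f n]: at most one of its terms
   is nonzero at a given point. *)
Definition combination (u : nat -> R) (t : X) : R := u (k t) * f (k t) t.

(** The choice of [k t] is immaterial: if [n] differs from it, both [f n] and [f (k t)] vanish at
    [t]. *)
Lemma combinationE (u : nat -> R) t n :
  (forall m, m != n -> f m t = 0) -> combination u t = u n * f n t.
Proof.
have [<-//|kn] := eqVneq (k t) n => nP.
by rewrite /combination nP// [in RHS]kP 1?eq_sym// !mulr0.
Qed.

Lemma combination_trunc (u : nat -> R) t N :
  \sum_(n < N) u n * f n t = if (k t < N)%N then combination u t else 0.
Proof.
case: ifP => [kN|/negbT kN].
  rewrite (bigD1 (Ordinal kN))//= big1 ?addr0// => n nk.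
  by rewrite kP ?mulr0.
rewrite big1// => n _; rewrite kP ?mulr0//.
by apply: contraNneq kN => <-.
Qed.

(** The partial sums converge uniformly: the only term they can miss at [t] is bounded by
    [|u (k t)|], with [k t >= N]. *)
Lemma combination_continuous (u : nat -> R) :
  u @ \oo --> (0 : R) -> continuous (combination u).
Proof.
move=> u0 t; apply/(@cvgrPdist_lt _ R^o) => e e0.
have e30 : 0 < e / 3 by lra.
have /(@cvgrPdist_lt _ R^o)/(_ _ e30) [N _ uN] := u0.
pose S y := \sum_(n < N) u n * f n y.
have Sc : continuous S.
  apply: continuous_sumr => n y.
  by apply: (@continuousM R); [exact: cst_continuous|exact: f_continuous].
have near_S y : `|combination u y - S y| <= e / 3.
  rewrite /S combination_trunc; case: ltnP => kN.
    by rewrite subrr normr0 ltW.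
  rewrite subr0 normrM -[leRHS]mulr1 ler_pM//.
  by have := uN _ kN; rewrite /= sub0r normrN => /ltW.
have /(@cvgrPdist_lt _ R^o)/(_ _ e30) := Sc t.
apply: filterS => y Sy.
have := near_S t; have := near_S y; move: Sy.
rewrite !ltr_norml !ler_norml; lra.
Qed.

End DisjointlySupported.

(** The [n]-th functional kills [f m] for [m != n] and is 1 on [f n], so [A] is a left inverse of
    [T]. *)
Lemma complemented_c0p (R : realType) (X : topologicalType)
    (f : nat -> X -> R) (I : nat -> finType) (c : forall n, I n -> R)
    (z : forall n, I n -> X) :
  (forall n, continuous (f n)) -> (forall n t, `|f n t| <= 1) ->
  (forall t m n, f m t != 0 -> f n t != 0 -> m = n) ->
  (forall n m i, m != n -> f m (z n i) = 0) ->
  (forall n, \sum_i c n i * f n (z n i) = 1) ->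
  (forall g : X -> R, continuous g ->
     (fun n => \sum_i c n i * g (z n i)) @ \oo --> (0 : R)) ->
  exists E : set (Cp R X), complemented E /\ linearly_homeomorphic E (c0p R).
Proof.
move=> fc f1 fd fz cf cg.
have [k kP] := exists_active_index fd.
have T_in (u : c0p R) : combination f k u \in @continuous_pred R X.
  apply/asboolP/combination_continuous => //.
  by have /asboolP := ptws_funP u.
pose T (u : c0p R) : Cp R X := PtwsSubspace (T_in u).
have A_in (g : Cp R X) :
    (fun n => \sum_i c n i * g (z n i)) \in @c0_pred R.
  by apply/asboolP/cg; have /asboolP := ptws_funP g.
pose A (g : Cp R X) : c0p R := PtwsSubspace (A_in g).
have T_lin : linear T.
  move=> a u v; apply: ptws_subspace_ext => t /=.
  by rewrite /combination /= mulrDl -mulrA.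
have A_lin : linear A.
  move=> a g h; apply: ptws_subspace_ext => n.
  rewrite -[LHS]/(\sum_i c n i * (a * g (z n i) + h (z n i))).
  rewrite -[RHS]/(a * (\sum_i c n i * g (z n i)) + \sum_i c n i * h (z n i)).
  rewrite mulr_sumr -big_split.
  apply: eq_bigr => i _ /=.
  by rewrite mulrDr mulrCA.
pose TL : {linear c0p R -> Cp R X} :=
  HB.pack T (GRing.isLinear.Build _ _ _ _ T T_lin).
pose AL : {linear Cp R X -> c0p R} :=
  HB.pack A (GRing.isLinear.Build _ _ _ _ A A_lin).
exists (range TL); apply: (@retract_complemented _ _ _ TL AL).
- exact: ptws_subspace_hausdorff.
- move=> u.
  apply/(@ptws_subspace_cvgP _ _ _ (T @ u) _
    (fmap_filter T (nbhs_filter u))) => t.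
  (* The value at [t] depends on the single coordinate [k t]. *)
  apply: (@continuousM R _ (fun v : c0p R => v (k t)) (cst (f (k t) t))).
    exact: ptws_subspace_eval_continuous.
  exact: cst_continuous.
- move=> g.
  apply/(@ptws_subspace_cvgP _ _ _ (A @ g) _
    (fmap_filter A (nbhs_filter g))) => n.
  apply: continuous_sumr => i h.
  apply: (@continuousM R _ (cst (c n i)) (fun v : Cp R X => v (z n i))).
    exact: cst_continuous.
  exact: ptws_subspace_eval_continuous.
- move=> u; apply: ptws_subspace_ext => n /=.
  under eq_bigr => i _.
    rewrite (combinationE kP u (fun m mn => fz n m i mn)) mulrCA.
    over.
  by rewrite -mulr_sumr cf mulr1.
Qed.

(** * Rademacher sums and their moments *)

Section Rademacher.
Variables (R : realType) (N : nat).
Implicit Types (s : {ffun 'I_N -> bool}) (i j : 'I_N) (b : 'I_N -> R).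

Lemma card_signs : #|{: {ffun 'I_N -> bool}}| = (2 ^ N)%N.
Proof. by rewrite card_ffun card_bool card_ord. Qed.

(** Orthogonality of the Rademacher functions: for [i != j], flipping the sign at [i] turns the sum
    into its opposite. *)
Lemma sum_signM i j :
  \sum_(s : {ffun 'I_N -> bool}) (-1) ^+ s i * (-1) ^+ s j =
  (2 ^+ N *+ (i == j) : R).
Proof.
have [<-|ij] := eqVneq i j.
  under eq_bigr => s _ do rewrite -signr_addb addbb.
  by rewrite sumr_const card_signs mulr1n -natrX.
pose flip (s : {ffun _ -> bool}) := [ffun l => s l (+) (l == i)].
have flipK : involutive flip.
  by move=> s; apply/ffunP => l; rewrite !ffunE -addbA addbb addbF.
rewrite mulr0n; set S := (LHS).
suff : S = - S by lra.
rewrite {1}/S (reindex_inj (can_inj flipK)) -sumrN; apply: eq_bigr => s _.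
rewrite !ffunE eqxx [j == i]eq_sym (negbTE ij) addbF addbT signrN.
by rewrite mulNr.
Qed.

Lemma sum_sqr_sign b :
  \sum_(s : {ffun 'I_N -> bool}) (\sum_i (-1) ^+ s i * b i) ^+ 2 =
  2 ^+ N * \sum_i b i ^+ 2.
Proof.
under eq_bigr => s _.
  rewrite expr2 big_distrlr /=.
  under eq_bigr => i _ do under eq_bigr => j _ do rewrite mulrACA.
  over.
rewrite exchange_big mulr_sumr; apply: eq_bigr => i _ /=.
rewrite exchange_big /= (bigD1 i)//= -mulr_suml sum_signM eqxx mulr1n expr2.
rewrite big1 ?addr0// => j ji.
by rewrite -mulr_suml sum_signM eq_sym (negbTE ji) mulr0n mul0r.
Qed.

(* AM-GM: [2 |T| sqrt N <= N + T^2], then the second moment is [2^N N]. *)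
Lemma sum_abs_sign_le b : (forall i, `|b i| <= 1) ->
  \sum_(s : {ffun 'I_N -> bool}) `|\sum_i (-1) ^+ s i * b i| <=
  2 ^+ N * Num.sqrt N%:R.
Proof.
move=> b1.
have [N0|N0] := posnP N.
  rewrite big1 ?mulr_ge0 ?sqrtr_ge0 ?exprn_ge0// => s _.
  by rewrite big1 ?normr0// => i; have := ltn_ord i; rewrite {2}N0.
set K := Num.sqrt _.
have K0 : 0 < K by rewrite sqrtr_gt0 ltr0n.
have KK : K ^+ 2 = N%:R by rewrite sqr_sqrtr.
rewrite -(ler_pM2r K0) -(ler_pM2l (@ltr0Sn R 1)) mulr_suml mulr_sumr.
apply: (@le_trans _ _
  (\sum_(s : {ffun 'I_N -> bool}) (K ^+ 2 + (\sum_i (-1) ^+ s i * b i) ^+ 2))).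
  apply: ler_sum => s _; rewrite -[X in _ <= _ + X]real_normK ?num_real//.
  set T := `|_|; have := sqr_ge0 (K - T); lra.
rewrite big_split /= sumr_const card_signs sum_sqr_sign.
have : \sum_i b i ^+ 2 <= K ^+ 2.
  rewrite KK -[in leRHS](card_ord N) -sumr_const.
  apply: ler_sum => i _; rewrite -real_normK ?num_real//.
  by rewrite expr_le1.
have P0 : 0 <= 2 ^+ N :> R by rewrite exprn_ge0.
rewrite -[_ *+ (2 ^ N)]mulr_natr natrX => /(ler_wpM2l P0); lra.
Qed.

Definition rademacher (p : {ffun 'I_N -> bool} * 'I_N) : R :=
  (-1) ^+ p.1 p.2 / (N%:R * 2 ^+ N).

Lemma sum_norm_rademacher : \sum_p `|rademacher p| <= 1.
Proof.
under eq_bigr => p _.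
  rewrite normrM normr_sign mul1r ger0_norm ?invr_ge0 ?mulr_ge0 ?exprn_ge0//.
  over.
rewrite sumr_const card_prod card_signs card_ord mulnC -[leLHS]mulr_natl.
rewrite natrM natrX.
have [->|N0] := posnP N; first by rewrite !mul0r.
by rewrite divff// mulf_neq0 ?expf_neq0// pnatr_eq0 -lt0n.
Qed.

(** Summing over [i] first leaves sign sums weighted by [a s]; bounding [|a s|] by [M] reduces the
    claim to [sum_abs_sign_le]. *)
Lemma rademacher_prod_le (M : R) (a : {ffun 'I_N -> bool} -> R) b :
  (forall s, `|a s| <= M) -> (forall i, `|b i| <= 1) ->
  `|\sum_p rademacher p * (a p.1 * b p.2)| <= M / Num.sqrt N%:R.
Proof.
move=> aM b1; have [N0|N0] := posnP N.
  (* For [N = 0] the sum is empty and the bound is 0, the inverse of 0 being 0. *)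
  rewrite big1 ?normr0; first by rewrite N0 sqrtr0 invr0 mulr0.
  by move=> [s i] _; have := ltn_ord i; rewrite {2}N0.
have K0 : 0 < Num.sqrt N%:R :> R by rewrite sqrtr_gt0 ltr0n.
have KK : Num.sqrt N%:R ^+ 2 = N%:R :> R by rewrite sqr_sqrtr.
rewrite -(pair_bigA _ (fun s i => rademacher (s, i) * (a s * b i))) /=.
have -> :
    \sum_(s : {ffun 'I_N -> bool}) \sum_i rademacher (s, i) * (a s * b i) =
    (N%:R * 2 ^+ N)^-1 *
    \sum_(s : {ffun 'I_N -> bool}) a s * \sum_i (-1) ^+ s i * b i.
  rewrite mulr_sumr; apply: eq_bigr => s _.
  rewrite !mulr_sumr; apply: eq_bigr => i _; rewrite /rademacher /=; ring.
have C0 : 0 < N%:R * 2 ^+ N :> R by rewrite mulr_gt0 ?exprn_gt0 ?ltr0n.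
rewrite normrM (@gtr0_norm _ (_^-1)) ?invr_gt0// ler_pdivrMl//.
have -> : N%:R * 2 ^+ N * (M / Num.sqrt N%:R) =
    M * (2 ^+ N * Num.sqrt N%:R) :> R.
  by rewrite -[X in X * _ * _]KK; field; rewrite gt_eqF.
have M0 : 0 <= M := le_trans (normr_ge0 _) (aM [ffun=> true]).
apply: le_trans (ler_wpM2l M0 (sum_abs_sign_le b1)).
apply: le_trans (ler_norm_sum _ _ _) _; rewrite mulr_sumr.
by apply: ler_sum => s _; rewrite normrM ler_wpM2r.
Qed.

End Rademacher.

(** * Decay of the functionals on continuous functions of two variables *)

(** Compactness of [K] makes continuity at [(x, y0)] uniform in [x] near [y0]; finitely many such
    neighbourhoods cover [L], and [c y] is the centre of one containing [y]. *)
Lemma continuous_compact_finite_net (R : realType) (K L : topologicalType)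
    (g : K * L -> R) (e : R) :
  compact [set: K] -> compact [set: L] -> continuous g -> 0 < e ->
  exists (D : seq L) (c : L -> L), [/\ uniq D, forall y, c y \in D &
    forall x y, `|g (x, y) - g (x, c y)| <= e].
Proof.
move=> /compact_near_coveringP Kc Lc gc e0.
have e20 : 0 < e / 2 by lra.
pose U y0 := [set y | [set: K] `<=` [set x | `|g (x, y) - g (x, y0)| <= e]].
have [y0|D DU] := compact_finite_cover (U := U) Lc.
  apply: (Kc _ (nbhs y0) (fun y x => `|g (x, y) - g (x, y0)| <= e)) => x0 _.
  have /(@cvgrPdist_lt _ R^o)/(_ _ e20) [[V W] /= [V0 W0] VW] := gc (x0, y0).
  exists (V, W) => // -[x y] /= [Vx Wy].
  have := VW (x, y) (conj Vx Wy).
  have := VW (x, y0) (conj Vx (nbhs_singleton W0)).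
  rewrite /= !ltr_norml ler_norml; lra.
have D2 y : exists y0, y0 \in D /\ U y0 y by have [y0 ? ?] := DU y; exists y0.
have [c cP] := choice D2.
exists (undup D), c; split=> [|y|x y]; first exact: undup_uniq.
  by rewrite mem_undup; case: (cP y).
by have [_ /(_ x I)] := cP y.
Qed.

(* Up to a uniformly small error, [g] is a finite sum of products of a function
   on [K] and a (discontinuous) indicator function on [L]. *)
Lemma rademacher_cvg0 (R : realType) (K L : topologicalType)
    (x : forall n, {ffun 'I_n.+1 -> bool} -> K) (y : forall n, 'I_n.+1 -> L)
    (g : K * L -> R) :
  compact [set: K] -> compact [set: L] -> continuous g ->
  (fun n => \sum_p rademacher R p * g (x n p.1, y n p.2)) @ \oo --> (0 : R).
Proof.
move=> Kc Lc gc.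
have [M M0 gM] : exists2 M, 0 <= M & forall z, `|g z| <= M.
  have : compact (g @` [set: K * L]).
    apply: continuous_compact; first exact: continuous_subspaceT.
    by rewrite -setXTT; exact: compact_setX.
  move=> /(@compact_bounded _ R^o)/ex_strict_bound_gt0[M M0 gM].
  by exists M; [exact: ltW|move=> t; apply/ltW/gM; exists t].
apply/(@cvgrPdist_le _ R^o) => e e0; have e20 : 0 < e / 2 by lra.
have [D [c [Du cD gD]]] := continuous_compact_finite_net Kc Lc gc e20.
(* The finite sum of products contributes at most [size D * M / sqrt n.+1], which is at most [e / 2]
   once [C <= sqrt n.+1]; [n >= C ^+ 2] suffices. *)
pose C := (size D)%:R * M / (e / 2).
have gE t l : g (t, l) = (g (t, l) - g (t, c l)) +
    \sum_(d <- D) g (t, d) * (c l == d)%:R.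
  rewrite (bigD1_seq (c l))//= eqxx mulr1 big1 ?addr0 ?subrK// => d dc.
  by rewrite eq_sym (negbTE dc) mulr0.
near=> n; rewrite sub0r normrN.
under eq_bigr => p _ do rewrite gE mulrDr mulr_sumr.
rewrite big_split exchange_big /= (splitr e).
apply: le_trans (ler_normD _ _) _; apply: lerD.
  apply: (@le_trans _ _ (\sum_p `|rademacher R p : R| * (e / 2))).
    apply: le_trans (ler_norm_sum _ _ _) _; apply: ler_sum => p _.
    by rewrite normrM ler_wpM2l.
  by rewrite -mulr_suml (ler_piMl (ltW e20))// sum_norm_rademacher.
apply: le_trans (ler_norm_sum _ _ _) _.
apply: (@le_trans _ _ (\sum_(d <- D) M / Num.sqrt n.+1%:R)).
  apply: ler_sum => d _.
  apply: (rademacher_prod_le (a := fun s => g (x n s, d))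
    (b := fun i => (c (y n i) == d)%:R)) => // i.
  by rewrite normr_nat lern1 leq_b1.
rewrite big_const_seq count_predT iter_addr_0 -[leLHS]mulr_natl mulrA.
have K0 : 0 < Num.sqrt n.+1%:R :> R by rewrite sqrtr_gt0 ltr0n.
rewrite ler_pdivrMr// -ler_pdivrMl// mulrC -/C.
have C0 : 0 <= C by rewrite !mulr_ge0 ?invr_ge0 ?(ltW e20).
rewrite -(ger0_norm C0) -sqrtr_sqr ler_wsqrtr//.
apply: (@le_trans _ _ n%:R); last by rewrite ler_nat.
by near: n; exact: nbhs_infty_ger.
Unshelve. all: by end_near.
Qed.

(** * Blocks of bumps and the final construction *)

Lemma ler1_norm_sum_disjoint (R : realType) (I : finType) (F : I -> R) :
  (forall i, `|F i| <= 1) -> (forall i j, F i != 0 -> F j != 0 -> i = j) ->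
  `|\sum_i F i| <= 1.
Proof.
move=> F1 Fd; have [[i Fi]|F0] := pselect (exists i, F i != 0).
  rewrite (bigD1 i)//= big1 ?addr0// => j ji; apply/eqP.
  by apply: contraNT ji => Fj; apply/eqP/Fd.
rewrite big1 ?normr0 ?ler01// => i _; apply/eqP.
by apply: contrapT => /negP Fi; apply: F0; exists i.
Qed.

Theorem corollary1p3 (R : realType) (K L : topologicalType)
  (K_compact : compact [set: K]) (K_hausdorff : hausdorff_space K)
  (K_infinite : infinite_set [set: K])
  (L_compact : compact [set: L]) (L_hausdorff : hausdorff_space L)
  (L_infinite : infinite_set [set: L]) :
  exists E : set (Cp R (K * L)%type),
    complemented E /\ linearly_homeomorphic E (c0p R).
Proof.
have [x [phi [phic phi01 phi1 phid]]] :=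
  compact_hausdorff_bumps R K_compact K_hausdorff K_infinite.
have [y [psi [psic psi01 psi1 psid]]] :=
  compact_hausdorff_bumps R L_compact L_hausdorff L_infinite.
(* Injective pairing of the block number with the position in the block keeps all blocks
   disjoint. *)
pose code (T : countType) (n : nat) (t : T) := pickle (n, pickle t).
(* Two types are allowed because [S m] and [S n] differ until [m = n] is known; only pickles can be
   compared. *)
have codeI (T T' : countType) n n' (t : T) (t' : T') :
    code T n t = code T' n' t' -> n = n' /\ pickle t = pickle t'.
  by move=> /(pcan_inj pickleK) [].
(* The size is [n.+1] because an empty block would give [f n = 0], against the normalisation. *)
pose S n := {ffun 'I_n.+1 -> bool}.
pose F n (p : S n * 'I_n.+1) (t : K * L) : R :=
  (-1) ^+ p.1 p.2 * (phi (code _ n p.1) t.1 * psi (code _ n p.2) t.2).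
have Fd m n (p : S m * 'I_m.+1) (q : S n * 'I_n.+1) t :
    F m p t != 0 -> F n q t != 0 ->
    [/\ m = n, pickle p.1 = pickle q.1 & pickle p.2 = pickle q.2].
  rewrite /F !mulf_eq0 !negb_or.
  move=> /and3P[_ phip psip] /and3P[_ phiq psiq].
  have [mn p1] := codeI _ _ _ _ _ _ (phid _ _ _ phip phiq).
  by have [_ p2] := codeI _ _ _ _ _ _ (psid _ _ _ psip psiq).
have FdI n (p q : S n * 'I_n.+1) t : F n p t != 0 -> F n q t != 0 -> p = q.
  move=> Fp Fq; have [_] := Fd _ _ _ _ _ Fp Fq.
  move=> /(pcan_inj pickleK) p1 /(pcan_inj pickleK) p2.
  by rewrite [p]surjective_pairing p1 p2 -surjective_pairing.
pose f n t := \sum_p F n p t.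
have fF n t : f n t != 0 -> exists p, F n p t != 0.
  move=> fn; apply: contrapT => F0; move/eqP: fn; apply.
  rewrite /f big1// => p _; apply/eqP; apply: contrapT => /negP Fp.
  by apply: F0; exists p.
pose z n (p : S n * 'I_n.+1) := (x (code _ n p.1), y (code _ n p.2)).
have Fz n p : F n p (z n p) = (-1) ^+ p.1 p.2.
  by rewrite /F /z /= phi1 psi1 !mulr1.
have fz n p : f n (z n p) = (-1) ^+ p.1 p.2.
  rewrite /f (bigD1 p)//= Fz big1 ?addr0// => q qp; apply/eqP.
  apply: contraNT qp => Fq; apply/eqP; apply: FdI Fq _.
  by rewrite Fz signr_eq0.
have fd t m n : f m t != 0 -> f n t != 0 -> m = n.
  move=> /fF[p Fp] /fF[q Fq].
  by have [] := Fd _ _ _ _ _ Fp Fq.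
apply: (@complemented_c0p _ _ f (fun n => (S n * 'I_n.+1)%type)
  (fun n p => rademacher R p) z).
- move=> n; apply: continuous_sumr => p t.
  apply: (@continuousM R _ (cst ((-1) ^+ p.1 p.2))
    (fun t => phi (code _ n p.1) t.1 * psi (code _ n p.2) t.2)).
    exact: cst_continuous.
  apply: (@continuousM R _ (phi (code _ n p.1) \o fst)
    (psi (code _ n p.2) \o snd)).
    by apply: continuous_comp; [exact: cvg_fst|exact: phic].
  by apply: continuous_comp; [exact: cvg_snd|exact: psic].
- move=> n t; apply: ler1_norm_sum_disjoint => [p|p q]; last exact: FdI.
  have /andP[a0 a1] := phi01 (code _ n p.1) t.1.
  have /andP[b0 b1] := psi01 (code _ n p.2) t.2.
  by rewrite normrM normr_sign mul1r ger0_norm ?mulr_ge0// mulr_ile1.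
- exact: fd.
(* At [z n p] the function [f n] is a sign, hence nonzero, so every other [f m] vanishes there. *)
- move=> n m p mn; apply/eqP; apply: contraNT mn => fm; apply/eqP.
  by apply: fd fm _; rewrite fz signr_eq0.
(* Signs square to 1, so the sum consists of [N 2^N] equal terms [1 / (N 2^N)], with [N = n.+1]. *)
- move=> n; under eq_bigr => p _ do
    rewrite fz /rademacher mulrAC -expr2 sqrr_sign mul1r.
  rewrite sumr_const card_prod card_signs card_ord -[LHS]mulr_natr.
  by rewrite natrM natrX [2 ^+ _ * _]mulrC mulVf// mulf_neq0 ?expf_neq0//.
- move=> g; exact: (rademacher_cvg0 (fun n s => x (code _ n s))
    (fun n i => y (code _ n i)) K_compact L_compact).
Qed.
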